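(* Let $n\in\mathbb{N}$ and for $i=1,\dots,5$ let $d_i=5n(i-1)+1$ and $R_i=\{5,d_i,25n-d_i,25n+d_i,50n-d_i,50n+d_i\}$. Then the graphs $C_{125n}(R_i)$, $1\le i\le5$, are Type-2 isomorphic circulant graphs w.r.t. $m=5$, $T2_{125n,5}(C_{125n}(R_i))=\{C_{125n}(R_j):j=1,2,3,4,5\}$ for each $i$, and $(T2_{125n,5}(C_{125n}(R_i)),\circ)$ is a group (the Type-2 group).
   Context: Circulant graph $C_N(R)$: vertices $v_0,\dots,v_{N-1}$, $v_x$ adjacent to $v_{x\pm s}$, $s\in R$; jump sets written in $[1,N/2]$ after reflexive reduction modulo $N$ (reduce mod $N$, replace values $>N/2$ by $N$ minus the value). For $m\mid N$, $0\le t\le\tfrac Nm-1$, $\theta_{N,m,t}$ maps $v_x$, $x=qm+j$, $0\le j\le m-1$, to $u_{x+jmt}$ (subscripts mod $N$) and edges to pairs of images; $\theta_{N,m,t}(C_N(R))$ is the image graph, written $C_N(\theta_{N,m,t}(R))$. Type-2 isomorphism w.r.t. $m$: $C_N(R)$, $C_N(S)$ with $|R|=|S|\ge3$, $R\ne S$, are Type-2 isomorphic w.r.t. $m$ if some $r\in R$ has $m>1$, $m\mid\gcd(N,r)$, $m^3\mid N$, $\theta_{N,m,t}(C_N(R))=C_N(S)$ for some $1\le t\le\tfrac Nm-1$, and $S\ne xR$ (reflexive mod $N$) for all $x$ coprime to $N$. $T2_{N,m}(C_N(R))=\{C_N(R)\}\cup\{C_N(S):C_N(S)$ Type-2 isomorphic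 to $C_N(R)$ w.r.t. $m\}$, with operation $\theta_{N,m,t}(C_N(R))\circ\theta_{N,m,t'}(C_N(R))=\theta_{N,m,t+t'}(C_N(R))$, $t+t'$ modulo $\tfrac Nm$. *)

(* Defs.v *)
From mathcomp Require Import all_boot finmap.
From mathcomp Require Import boolp classical_sets.

Set Implicit Arguments.
Unset Strict Implicit.
Unset Printing Implicit Defensive.

(* The vertex v_x (or u_x) is x : 'I_N, so a graph on N vertices is given by  *)
(* its set of edges, an edge being an unordered pair of vertices.             *)
Definition graph (N : nat) : Type := {set {set 'I_N}}.

Definition refl_mod (N s : nat) : nat :=
  if (s %% N).*2 <= N then s %% N else N - s %% N.

Definition refl_reduce (N : nat) (R : {fset nat}) : {fset nat} :=
  [fset refl_mod N s | s in R]%fset.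

Definition jump_set (N : nat) (R : {fset nat}) : Prop :=
  forall s, s \in R -> 0 < s /\ s.*2 <= N.

(* y = x + s or y = x - s modulo N for some s in R *)
Definition jump_adj (N : nat) (R : {fset nat}) (x y : 'I_N) : bool :=
  has (fun s => (y == x + s %[mod N]) || (y + s == x %[mod N])) R.

Definition circulant (N : nat) (R : {fset nat}) : graph N :=
  [set e : {set 'I_N} |
     [exists x, exists y, jump_adj R x y && (e == [set x; y])]]%SET.

Definition theta (N m t : nat) (x : 'I_N) : 'I_N :=
  Ordinal (ltn_pmod (x + (x %% m) * m * t)
                    (leq_ltn_trans (leq0n x) (ltn_ord x))).

Definition theta_graph (N m t : nat) (G : graph N) : graph N :=
  [set [set theta m t x | x in e] | e : {set 'I_N} in G]%SET.

Definition scale_jumps (N x : nat) (R : {fset nat}) : {fset nat} :=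
  refl_reduce N [fset (x * s)%N | s in R]%fset.

Definition type2_iso (N m : nat) (R S : {fset nat}) : Prop :=
  [/\ jump_set N R /\ jump_set N S,
      #|` R| = #|` S| /\ 3 <= #|` R|,
      R <> S,
      exists r, [/\ r \in R, 1 < m, m %| gcdn N r & m ^ 3 %| N]
      & (exists t, 1 <= t <= N %/ m - 1 /\
           theta_graph m t (circulant N R) = circulant N S) /\
        (forall x, coprime x N -> S <> scale_jumps N x R)].

Definition T2 (N m : nat) (R : {fset nat}) : set (graph N) :=
  ([set circulant N R] `|`
   [set G | exists S, type2_iso N m R S /\ G = circulant N S])%classic.
Arguments T2 : clear implicits.

(* When m divides N > 0, every element of T2 N m R has the form               *)
(* theta_graph m t (circulant N R) with t < N %/ m, but t need not be unique. *)
(* The condition ranges over all such t, so it includes the well-definedness  *)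
(* of the operation and determines op completely.                             *)
Definition is_type2_op (N m : nat) (R : {fset nat})
    (op : T2 N m R -> T2 N m R -> T2 N m R) : Prop :=
  forall (G H : T2 N m R) (t t' : nat),
    t < N %/ m -> t' < N %/ m ->
    val G = theta_graph m t (circulant N R) ->
    val H = theta_graph m t' (circulant N R) ->
    val (op G H) = theta_graph m ((t + t') %% (N %/ m)) (circulant N R).

Definition is_group (T : Type) (op : T -> T -> T) : Prop :=
  exists (e : T) (inv : T -> T),
    [/\ associative op, left_id e op, right_id e op,
        left_inverse e inv op & right_inverse e inv op].

Definition d_ (n i : nat) : nat := 5 * n * (i - 1) + 1.

(* For i = 4, 5 the jump 50n + d_i exceeds 125n / 2, so the set as written    *)
(* has to be reduced.                                                         *)
Definition R_ (n i : nat) : {fset nat} :=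
  refl_reduce (125 * n)
    [fset 5; d_ n i; (25 * n - d_ n i)%N; (25 * n + d_ n i)%N;
          (50 * n - d_ n i)%N; (50 * n + d_ n i)%N]%fset.

(* Main.v *)
Require Import Defs.
From mathcomp Require Import all_boot finmap.
From mathcomp Require Import boolp classical_sets.
From mathcomp Require Import ssralg ssrnum ssrint intdiv zmodp.
From mathcomp Require Import zify ring.

(* Modulo 125n, the symmetrized jump set of R_i is {5, -5} together with the   *)
(* two cosets d_i + 25nZ and - d_i + 25nZ. The map theta_t shifts a difference *)
(* s = 0 mod 5 by nothing and a difference s = 1 mod 5 by 5t or by -20t,       *)
(* according to the residue class of the starting vertex. Hence the image is   *)
(* circulant only if 25t = 0 mod 25n, i.e. t = nc, and then theta_t sends R_i  *)
(* to R_(i+c), indices being taken modulo 5: this is an action of Z/5. A       *)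
(* multiplier x with xR_i = R_j must fix {5, -5}, so x = 1 or -1 mod 25n and   *)
(* thus preserves the cosets, which forces i = j.                              *)

Set Implicit Arguments.
Unset Strict Implicit.
Unset Printing Implicit Defensive.

Import GRing.Theory.

(** A circulant graph is determined by its symmetrized jump set, kept here as the periodic set of
    integers [conn N R]; adjacency is a condition on differences ([jump_adjE]), and reflexive
    reduction leaves that set unchanged ([conn_refl_reduce]). Everything about [R_ n k.+1] then goes
    through its description by cosets, [conn_RP].

    Two facts about [theta] carry the proof. With [t = n * c] it moves the index [k] to [k + c]
    modulo 5 ([theta_circulant_R]), and no other [t] gives a circulant image
    ([theta_circulant_dvd]). So the five graphs form one orbit and exhaust the Type-2 set. They are
    pairwise distinct and not related by a multiplier ([conn_R_scale_eq]), hence correspond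
    bijectively to Z/5, whose addition becomes the Type-2 operation. *)

(** * Circulant adjacency as congruences between integers *)

Definition conn (N : nat) (R : {fset nat}) (z : int) : bool :=
  has (fun s : nat => (N%:Z %| (z - s%:Z)%R)%Z || (N%:Z %| (z + s%:Z)%R)%Z) R.

Lemma connP (N : nat) (R : {fset nat}) (z : int) :
  reflect (exists2 s, s \in R &
             (N%:Z %| (z - s%:Z)%R)%Z \/ (N%:Z %| (z + s%:Z)%R)%Z)
          (conn N R z).
Proof. by apply: (iffP hasP) => -[s sR /orP]; exists s. Qed.

Lemma eqn_mod_dvdz (N a b : nat) :
  (a == b %[mod N]) = (N%:Z %| (a%:Z - b%:Z)%R)%Z.
Proof. by rewrite -eqz_mod_dvd !modz_nat eqz_nat. Qed.

Lemma jump_adjE (N : nat) (R : {fset nat}) (x y : 'I_N) :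
  jump_adj R x y = conn N R (y%:Z - x%:Z)%R.
Proof.
apply: eq_has => s; rewrite !eqn_mod_dvdz !PoszD.
by congr (_ || _); congr (_ %| _)%Z; ring.
Qed.

Lemma dvdzDr (d a b : int) : (d %| a)%Z -> (d %| (a + b)%R)%Z = (d %| b)%Z.
Proof. by move=> da; rewrite rpredDl. Qed.

Lemma dvdzN (d a : int) : (d %| (- a)%R)%Z = (d %| a)%Z.
Proof. exact: rpredN. Qed.

Lemma conn_mod (N : nat) (R : {fset nat}) (z w : int) :
  (N%:Z %| (z - w)%R)%Z -> conn N R z = conn N R w.
Proof.
move=> zw; apply: eq_has => s.
have E (u : int) : (z + u = (z - w) + (w + u))%R by ring.
by rewrite (E (Posz s)) (E (- Posz s)%R); rewrite !(dvdzDr _ zw).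
Qed.

Lemma conn_opp (N : nat) (R : {fset nat}) (z : int) :
  conn N R (- z)%R = conn N R z.
Proof.
apply: eq_has => s; rewrite orbC.
have -> : (- z + s%:Z = - (z - s%:Z))%R by ring.
by rewrite -opprD !dvdzN.
Qed.

Lemma jump_adj_sym (N : nat) (R : {fset nat}) (x y : 'I_N) :
  jump_adj R x y = jump_adj R y x.
Proof. by rewrite !jump_adjE -conn_opp opprB. Qed.

Lemma set2_eqP (T : finType) (x y a b : T) :
  [set x; y]%SET = [set a; b]%SET -> (x = a /\ y = b) \/ (x = b /\ y = a).
Proof.
move=> E.
have xE : x \in [set a; b]%SET by rewrite -E !inE eqxx.
have yE : y \in [set a; b]%SET by rewrite -E !inE eqxx orbT.
have aE : a \in [set x; y]%SET by rewrite E !inE eqxx.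
have bE : b \in [set x; y]%SET by rewrite E !inE eqxx orbT.
move: xE yE aE bE; rewrite !inE.
by do 4 case/orP=> /eqP ?; subst; auto.
Qed.

Lemma circulant_edge (N : nat) (R : {fset nat}) (x y : 'I_N) :
  ([set x; y]%SET \in circulant N R) = jump_adj R x y.
Proof.
rewrite inE; apply/existsP/idP => [[a /existsP[b /andP[ab /eqP E]]]|xy].
  by case: (set2_eqP E) => -[-> ->] //; rewrite jump_adj_sym.
by exists x; apply/existsP; exists y; rewrite xy eqxx.
Qed.

Lemma circulant_pair (N : nat) (R : {fset nat}) (e : {set 'I_N}) :
  e \in circulant N R -> exists x y, e = [set x; y]%SET.
Proof.
by rewrite inE => /existsP[x /existsP[y /andP[_ /eqP ->]]]; exists x, y.
Qed.

(** The shift is a multiple of [m], so [theta] preserves each residue class modulo [m], and on such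
    a class it is a translation. *)
Lemma theta_inj (N m t : nat) : m %| N -> injective (@theta N m t).
Proof.
move=> mN x y /(congr1 val) /= E.
have thmod (z : nat) : (z + z %% m * m * t) %% m = z %% m.
  by rewrite mulnAC addnC modnMDl.
have Em : x %% m = y %% m.
  by move: (congr1 (modn^~ m) E); rewrite /= !modn_dvdm // !thmod.
move: E; rewrite Em => /eqP; rewrite eqn_modDr !modn_small ?ltn_ord //.
by move=> /eqP /val_inj.
Qed.

(** Since [theta] permutes the vertices, equality of edge sets can be tested pair by pair. *)
Lemma theta_graph_circulantP (N m t : nat) (R S : {fset nat}) :
  m %| N ->
  theta_graph m t (circulant N R) = circulant N S <->
  forall x y : 'I_N, jump_adj R x y = jump_adj S (theta m t x) (theta m t y).
Proof.
move=> mN; have thI := @theta_inj N m t mN.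
have thE (x y : 'I_N) : [set theta m t z | z in [set x; y]%SET]%SET =
    [set theta m t x; theta m t y]%SET by rewrite imsetU1 imset_set1.
split=> [E x y|adjE].
  by rewrite -!circulant_edge -E -thE (mem_imset _ _ (imset_inj thI)).
apply/setP=> e; apply/imsetP/idP => [[e' e'R ->]|eS].
  case: (circulant_pair e'R) => x [y e'E]; move: e'R.
  by rewrite e'E thE !circulant_edge adjE.
case: (circulant_pair eS) => x [y eE].
have [h hK Kh] := injF_bij thI.
exists [set h x; h y]%SET; last by rewrite thE !Kh.
by rewrite circulant_edge adjE !Kh -circulant_edge -eE.
Qed.

(** The jumps can be read off from the neighbours of vertex 0, because the interval from 1 to
    [N / 2] contains at most one representative of each class up to sign. *)
Lemma circulant_inj (N : nat) (R S : {fset nat}) :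
  jump_set N R -> jump_set N S -> circulant N R = circulant N S -> R = S.
Proof.
have incl (A B : {fset nat}) : jump_set N A -> jump_set N B ->
    circulant N A = circulant N B -> {subset A <= B}.
  move=> jA jB E s sA; have [s0 sN] := jA _ sA.
  have N0 : 0 < N by lia.
  have ltsN : s < N by lia.
  have : jump_adj A (Ordinal N0) (Ordinal ltsN).
    by rewrite /jump_adj; apply/hasP; exists s; rewrite //= add0n eqxx.
  rewrite -circulant_edge E circulant_edge jump_adjE => /connP[r rB /=].
  have [r0 rN] := jB _ rB.
  rewrite subr0 => -[] /dvdzP[q Eq]; suff: s = r by move=> ->.
    have : q = 0%R by nia.
    by move=> q0; move: Eq; rewrite q0; lia.
  have : q = 1%R by nia.
  by move=> q1; move: Eq; rewrite q1; lia.
move=> jR jS E; apply/fsetP => s; apply/idP/idP; exact: incl.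
Qed.

(** * Reflexive reduction and multipliers *)

Lemma refl_mod_cong (N s : nat) : 0 < N ->
  (N%:Z %| ((refl_mod N s)%:Z - s%:Z)%R)%Z \/
  (N%:Z %| ((refl_mod N s)%:Z + s%:Z)%R)%Z.
Proof.
move=> N0; have lt := ltn_pmod s N0; have E := divn_eq s N.
rewrite /refl_mod; case: ifP => _.
  by left; apply/dvdzP; exists (- (s %/ N)%:Z)%R; lia.
by right; apply/dvdzP; exists ((s %/ N)%:Z + 1)%R; lia.
Qed.

Lemma conn_refl_reduce (N : nat) (R : {fset nat}) (z : int) : 0 < N ->
  conn N (refl_reduce N R) z = conn N R z.
Proof.
move=> N0; apply/connP/connP => [[_ /imfsetP[/= s sR ->]]|[s sR]] H.
  exists s => //; case: (refl_mod_cong s N0) H => /dvdzP[q Eq] [] /dvdzP[p Ep];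
  [left|right|right|left]; apply/dvdzP;
  [exists (p + q)%R|exists (p - q)%R|exists (p + q)%R|exists (p - q)%R]; lia.
exists (refl_mod N s); first by apply: in_imfset.
case: (refl_mod_cong s N0) H => /dvdzP[q Eq] [] /dvdzP[p Ep];
  [left|right|right|left]; apply/dvdzP;
  [exists (p - q)%R|exists (p + q)%R|exists (p + q)%R|exists (p - q)%R]; lia.
Qed.

Lemma conn_scale (N x : nat) (R : {fset nat}) (z : int) : 0 < N ->
  conn N R z -> conn N (scale_jumps N x R) (x%:Z * z)%R.
Proof.
move=> N0 /connP[s sR H]; rewrite conn_refl_reduce //; apply/connP.
exists (x * s); first by apply: in_imfset.
by case: H => /dvdzP[q Eq]; [left|right]; apply/dvdzP; exists (x%:Z * q)%R;
  rewrite PoszM -mulrA -Eq; ring.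
Qed.

Lemma refl_reduce_jump_set (N : nat) (R : {fset nat}) : 0 < N ->
  (forall s, s \in R -> ~~ (N %| s)) -> jump_set N (refl_reduce N R).
Proof.
move=> N0 RN _ /imfsetP[/= s sR ->]; have lt := ltn_pmod s N0.
by move: (RN _ sR); rewrite /dvdn /refl_mod; case: ifP; lia.
Qed.

(** * The jump sets R_i *)

Lemma d_S (n k : nat) : d_ n k.+1 = 5 * (n * k) + 1.
Proof. by rewrite /d_ subSS subn0 mulnA. Qed.

(** Up to sign, the five jumps other than 5 are d + 25nr with r between -2 and 2, a full set of
    residues modulo 5; so modulo 125n they fill the whole coset of d modulo 25n. *)
Lemma conn_RP (n k : nat) (z : int) : 0 < n -> k < 5 ->
  conn (125 * n) (R_ n k.+1) z <->
  exists q : int,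
    [\/ z = (5 + 125 * n%:Z * q)%R, z = (- 5 + 125 * n%:Z * q)%R,
        z = (5 * (n%:Z * k%:Z) + 1 + 25 * n%:Z * q)%R |
        z = (- (5 * (n%:Z * k%:Z) + 1) + 25 * n%:Z * q)%R].
Proof.
move=> n0 k5; have nk4 : n * k <= 4 * n by nia.
rewrite conn_refl_reduce ?muln_gt0 // d_S.
split=> [/connP[s]|[q zE]].
  rewrite !inE -!orbA => sR H.
  have {H} [q H] : exists q : int,
      z = (s%:Z + 125 * n%:Z * q)%R \/ z = (- s%:Z + 125 * n%:Z * q)%R.
    by case: H => /dvdzP[q Eq]; exists q; [left|right]; lia.
  case/orP: sR => [|/orP[|/orP[|/orP[|/orP[]]]]] /eqP sE.
  - exists q; case: H => ->; [constructor 1|constructor 2]; lia.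
  - exists (5 * q)%R; case: H => ->; [constructor 3|constructor 4]; lia.
  - case: H => ->; [exists (5 * q + 1)%R; constructor 4
                   |exists (5 * q - 1)%R; constructor 3]; lia.
  - case: H => ->; [exists (5 * q + 1)%R; constructor 3
                   |exists (5 * q - 1)%R; constructor 4]; lia.
  - case: H => ->; [exists (5 * q + 2)%R; constructor 4
                   |exists (5 * q - 2)%R; constructor 3]; lia.
  - case: H => ->; [exists (5 * q + 2)%R; constructor 3
                   |exists (5 * q - 2)%R; constructor 4]; lia.
pose D (p : int) (s : nat) :=
  z = (s%:Z + 125 * n%:Z * p)%R \/ z = (- s%:Z + 125 * n%:Z * p)%R.
suff [s sR [p Dps]] : exists2 s,
    s \in [fset 5; (5 * (n * k) + 1)%N; (25 * n - (5 * (n * k) + 1))%N;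
      (25 * n + (5 * (n * k) + 1))%N; (50 * n - (5 * (n * k) + 1))%N;
      (50 * n + (5 * (n * k) + 1))%N]%fset & exists p, D p s.
  apply/connP; exists s => //.
  by case: Dps => ->; [left|right]; apply/dvdzP; exists p; lia.
(* The balanced remainder [r] selects the jump: d, 25n + d or 50n + d for one sign, 25n - d or 50n -
   d for the other. *)
have [p [r [qE r04]]] : exists p r : int, q = (5 * p + r)%R /\
    [\/ r = 0%R, r = 1%R, r = 2%R | r = (-1)%R \/ r = (-2)%R].
  have : (q %% 5)%Z = 0%R \/ (q %% 5)%Z = 1%R \/ (q %% 5)%Z = 2%R \/
      (q %% 5)%Z = 3%R \/ (q %% 5)%Z = 4%R by lia.
  case=> [|[|[|[|]]]] E.
  - exists (q %/ 5)%Z, 0%R; split; [lia|by constructor 1].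
  - exists (q %/ 5)%Z, 1%R; split; [lia|by constructor 2].
  - exists (q %/ 5)%Z, 2%R; split; [lia|by constructor 3].
  - exists ((q %/ 5)%Z + 1)%R, (-2)%R; split; [lia|by constructor 4; right].
  - exists ((q %/ 5)%Z + 1)%R, (-1)%R; split; [lia|by constructor 4; left].
case: zE => zE.
- by exists 5; [rewrite !inE|exists q; left].
- by exists 5; [rewrite !inE|exists q; right].
- case: r04 => [rE|rE|rE|[rE|rE]];
  [exists (5 * (n * k) + 1)|exists (25 * n + (5 * (n * k) + 1))
  |exists (50 * n + (5 * (n * k) + 1))|exists (25 * n - (5 * (n * k) + 1))
  |exists (50 * n - (5 * (n * k) + 1))]; rewrite ?inE ?eqxx ?orbT //;
  exists p; rewrite /D zE qE rE; [left|left|left|right|right]; lia.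
- case: r04 => [rE|rE|rE|[rE|rE]];
  [exists (5 * (n * k) + 1)|exists (25 * n - (5 * (n * k) + 1))
  |exists (50 * n - (5 * (n * k) + 1))|exists (25 * n + (5 * (n * k) + 1))
  |exists (50 * n + (5 * (n * k) + 1))]; rewrite ?inE ?eqxx ?orbT //;
  exists p; rewrite /D zE qE rE; [right|left|left|right|right]; lia.
Qed.

Lemma R_jump_set (n k : nat) : 0 < n -> k < 5 -> jump_set (125 * n) (R_ n k.+1).
Proof.
move=> n0 k5; have nk4 : n * k <= 4 * n by nia.
apply: refl_reduce_jump_set => [|s]; first by rewrite muln_gt0.
rewrite d_S !inE => sR; apply/negP => /dvdnP[q sE].
have [q0 q1] : 0 < q /\ q < 1 by nia.
by lia.
Qed.

Lemma cardfsUx1 (K : choiceType) (A : {fset K}) (x : K) :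
  #|` (A `|` [fset x])%fset| = (x \notin A) + #|` A|.
Proof. by rewrite fsetUC cardfsU1. Qed.

Lemma card_R (n k : nat) : 0 < n -> k < 5 -> #|` R_ n k.+1| = 6.
Proof.
move=> n0 k5; have nk4 : n * k <= 4 * n by nia.
rewrite /R_ d_S card_in_imfset /=.
  rewrite !cardfsUx1 cardfs1 !inE !negb_or.
  by do 15! [match goal with |- context [?a == ?b] =>
    have -> : (a == b) = false by lia end].
move=> s r; rewrite !inE -!orbA /refl_mod => sR rR.
have sN : s < 125 * n by case/or4P: sR => [| | |/or3P[]] /eqP ->; lia.
have rN : r < 125 * n by case/or4P: rR => [| | |/or3P[]] /eqP ->; lia.
rewrite !modn_small // => E.
(* Two jumps never add up to 125n: modulo 5 this would need 5 twice or opposite signs of d, and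
   these sums are 10 or at most 100n. *)
have {E} [//|E] : s = r \/ s + r = 125 * n.
  by move: E; case: ifP => _; case: ifP => _; lia.
by case/or4P: sR => [| | |/or3P[]] /eqP sE;
  case/or4P: rR => [| | |/or3P[]] /eqP rE; lia.
Qed.

(** * The action of theta on the R_i *)

Lemma theta_sub (N m t : nat) (x y : 'I_N) :
  (N%:Z %| (((theta m t y)%:Z - (theta m t x)%:Z) -
    ((y%:Z - x%:Z) + m%:Z * t%:Z * ((y %% m)%:Z - (x %% m)%:Z)))%R)%Z.
Proof.
have thE (z : 'I_N) : exists q : int,
    ((theta m t z)%:Z = z%:Z + m%:Z * t%:Z * (z %% m)%:Z + q * N%:Z)%R.
  exists (- ((z + z %% m * m * t) %/ N)%:Z)%R => /=.
  move: (divn_eq (z + z %% m * m * t) N); lia.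
have [p ->] := thE x; have [q ->] := thE y.
by apply/dvdzP; exists (q - p)%R; lia.
Qed.

(** Here [e] stands for the difference of the residues of two vertices. If [z] is 1 modulo 5, then
    [e] is 1 or -4, and the shifts 5nc and -20nc agree modulo 25n: both carry the coset of d for [k]
    to that for [k + c]. *)
Lemma conn_R_shift_sub (n k c : nat) (z e : int) : 0 < n -> k < 5 ->
  (exists u : int, z = e + 5 * u)%R -> (-5 < e < 5)%R ->
  conn (125 * n) (R_ n k.+1) z ->
  conn (125 * n) (R_ n ((k + c) %% 5).+1) (z + 5 * n%:Z * c%:Z * e)%R.
Proof.
move=> n0 k5 [u zE] e5.
have c5 : (k + c) %% 5 < 5 by lia.
have [w wE] : exists w : nat, k + c = w * 5 + (k + c) %% 5.
  by exists ((k + c) %/ 5); exact: divn_eq.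
have kc : (((k + c) %% 5)%:Z = k%:Z + c%:Z - 5 * w%:Z)%R by lia.
move=> /conn_RP -/(_ n0 k5)[q H]; apply/conn_RP => //; rewrite kc.
case: H => H.
- have -> : e = 0%R by lia.
  by exists q; constructor 1; lia.
- have -> : e = 0%R by lia.
  by exists q; constructor 2; lia.
- have [->|->] : e = 1%R \/ e = (-4)%R by lia.
    by exists (q + w%:Z)%R; constructor 3; lia.
  by exists (q + w%:Z - c%:Z)%R; constructor 3; lia.
- have [->|->] : e = (-1)%R \/ e = 4%R by lia.
    by exists (q - w%:Z)%R; constructor 4; lia.
  by exists (q - w%:Z + c%:Z)%R; constructor 4; lia.
Qed.

Lemma conn_R_shift (n k c : nat) (z e : int) : 0 < n -> k < 5 ->
  (exists u : int, z = e + 5 * u)%R -> (-5 < e < 5)%R ->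
  conn (125 * n) (R_ n ((k + c) %% 5).+1) (z + 5 * n%:Z * c%:Z * e)%R =
  conn (125 * n) (R_ n k.+1) z.
Proof.
move=> n0 k5 [u zE] e5; apply/idP/idP; last first.
  by apply: conn_R_shift_sub => //; exists u.
(* Shifting by [24 * c] inverts the shift by [c]: together they move [z] by 125nce and the index by
   25c. *)
move=> /(@conn_R_shift_sub _ _ (24 * c) _ e n0) H.
have {1}<- : ((k + c) %% 5 + 24 * c) %% 5 = k by lia.
rewrite -(@conn_mod _ _ (z + 5 * n%:Z * c%:Z * e +
    5 * n%:Z * (24 * c)%:Z * e)%R).
  apply: H => //; first by lia.
  by exists (u + n%:Z * c%:Z * e)%R; lia.
by apply/dvdzP; exists (c%:Z * e)%R; lia.
Qed.

Lemma theta_circulant_R (n k c : nat) : 0 < n -> k < 5 ->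
  theta_graph 5 (n * c) (circulant (125 * n) (R_ n k.+1)) =
  circulant (125 * n) (R_ n ((k + c) %% 5).+1).
Proof.
move=> n0 k5; apply/theta_graph_circulantP.
  by apply/dvdnP; exists (25 * n); lia.
move=> x y; rewrite !jump_adjE (conn_mod _ (theta_sub _ _ _ _)).
rewrite -(@conn_R_shift n k c _ ((y %% 5)%:Z - (x %% 5)%:Z)%R) //; last by lia.
  by rewrite PoszM mulrA.
exists ((y %/ 5)%:Z - (x %/ 5)%:Z)%R; lia.
Qed.

(* In theta(C(R)) the residue classes 0 and 4 modulo 5 see the jumps congruent *)
(* to 1 modulo 5 shifted by 5t and by -20t respectively; if the image is       *)
(* circulant, the two shifts agree modulo 25n.                                 *)
Lemma theta_circulant_dvd (n k t : nat) (S : {fset nat}) : 0 < n -> k < 5 ->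
  theta_graph 5 t (circulant (125 * n) (R_ n k.+1)) = circulant (125 * n) S ->
  n %| t.
Proof.
move=> n0 k5 /theta_graph_circulantP adjE.
have nk4 : n * k <= 4 * n by nia.
have N0 : 0 < 125 * n by lia.
have {}adjE := adjE (dvdn_mulr _ (isT : 5 %| 125)).
pose d := 5 * (n * k) + 1.
have dN : d < 125 * n by lia.
have N4 : 4 < 125 * n by lia.
(* The term 25t makes up for the gap between 5t and -20t: the images of 4 and [y] differ by d + 5t,
   as do those of 0 and d. *)
pose y : 'I_(125 * n) := Ordinal (ltn_pmod (4 + d + 25 * t) N0).
have y5 : y %% 5 = 0.
  rewrite /= modn_dvdm; last by apply/dvdnP; exists (25 * n); lia.
  by lia.
have yE : exists q : int, (y%:Z = 4 + d%:Z + 25 * t%:Z + 125 * n%:Z * q)%R.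
  exists (- ((4 + d + 25 * t) %/ (125 * n))%:Z)%R.
  by move: (divn_eq (4 + d + 25 * t) (125 * n)) => /=; lia.
have : jump_adj S (theta 5 t (Ordinal N0)) (theta 5 t (Ordinal dN)).
  rewrite -adjE jump_adjE; apply/conn_RP => //.
  by exists 0%R; constructor 3; rewrite /=; lia.
rewrite jump_adjE (conn_mod _ (theta_sub _ _ _ _)) => S05.
have : jump_adj S (theta 5 t (Ordinal N4)) (theta 5 t y).
  rewrite jump_adjE (conn_mod _ (theta_sub _ _ _ _)) y5; move: S05.
  congr (is_true _); apply: conn_mod; have [q ->] := yE.
  apply/dvdzP; exists (- q)%R.
  have -> : Ordinal dN %% 5 = 1 by rewrite /= /d; lia.
  by rewrite /=; lia.
rewrite -adjE jump_adjE; have [p ->] := yE.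
move=> /conn_RP -/(_ n0 k5)[q].
have -> : (d%:Z = 5 * (n%:Z * k%:Z) + 1)%R by rewrite /d; lia.
rewrite /= => -[] E; [lia|lia| |lia].
have tE : (t%:Z = (q - 5 * p) * n%:Z)%R by lia.
have : (Posz n %| Posz t)%Z by apply/dvdzP; exists (q - 5 * p)%R.
by [].
Qed.

(** * Separation of the R_i, also under multipliers *)

(** The only multiples of 5 in the symmetrized set are 5 and -5 modulo 125n, which pins [x] to 1 or
    -1 modulo 25n. The case [x = 1] also yields that the R_i are distinct. *)
Lemma conn_R_scale_eq (n k l x : nat) : 0 < n -> k < 5 -> l < 5 ->
  (forall z, conn (125 * n) (R_ n k.+1) z ->
     conn (125 * n) (R_ n l.+1) (x%:Z * z)%R) -> k = l.
Proof.
move=> n0 k5 l5 H.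
have [p pE] : exists p : int,
    (x%:Z = 1 + 25 * n%:Z * p)%R \/ (x%:Z = - 1 + 25 * n%:Z * p)%R.
  have : conn (125 * n) (R_ n k.+1) 5%R.
    by apply/conn_RP => //; exists 0%R; constructor 1; lia.
  move/H => /conn_RP -/(_ n0 l5)[q [] E]; exists q;
    [left|right|left|right]; lia.
have : conn (125 * n) (R_ n k.+1) (5 * (n%:Z * k%:Z) + 1)%R.
  by apply/conn_RP => //; exists 0%R; constructor 3; lia.
move/H => /conn_RP -/(_ n0 l5)[q E].
have [r rE] : exists r : int,
    (5 * (n%:Z * k%:Z) = 5 * (n%:Z * l%:Z) + 25 * n%:Z * r)%R.
  case: pE E => -> [] E; try lia.
    by exists (q - p * (5 * (n%:Z * k%:Z) + 1))%R; lia.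
  by exists (p * (5 * (n%:Z * k%:Z) + 1) - q)%R; lia.
suff : (k%:Z = l%:Z + 5 * r)%R by lia.
have : (5 * n%:Z * (k%:Z - (l%:Z + 5 * r)) = 0)%R by lia.
by move/eqP; rewrite mulf_eq0 => /orP[|] /eqP; lia.
Qed.

Lemma R_neq_scale (n k l x : nat) : 0 < n -> k < 5 -> l < 5 -> k <> l ->
  R_ n l.+1 <> scale_jumps (125 * n) x (R_ n k.+1).
Proof.
move=> n0 k5 l5 kl E; apply: kl; apply: (@conn_R_scale_eq n k l x) => // z kz.
by rewrite E conn_scale // muln_gt0.
Qed.

Lemma R_inj (n k l : nat) : 0 < n -> k < 5 -> l < 5 ->
  R_ n k.+1 = R_ n l.+1 -> k = l.
Proof.
move=> n0 k5 l5 E; apply: (@conn_R_scale_eq n k l 1) => // z.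
by rewrite mul1r E.
Qed.

Lemma circulant_R_inj (n k l : nat) : 0 < n -> k < 5 -> l < 5 ->
  circulant (125 * n) (R_ n k.+1) = circulant (125 * n) (R_ n l.+1) -> k = l.
Proof.
move=> n0 k5 l5 /circulant_inj E.
by apply: (@R_inj n) => //; apply: E; apply: R_jump_set.
Qed.

(** * The Type-2 set and its group *)

Lemma type2_iso_R (n k l : nat) : 0 < n -> k < 5 -> l < 5 -> k <> l ->
  type2_iso (125 * n) 5 (R_ n k.+1) (R_ n l.+1).
Proof.
move=> n0 k5 l5 kl; split; first by split; apply: R_jump_set.
- by rewrite !card_R.
- by move/R_inj => E; apply: kl; apply: E.
- exists 5; split=> //; last by apply/dvdnP; exists n; lia.
    apply/imfsetP; exists 5; first by rewrite !inE.
    by rewrite /refl_mod modn_small ?ifT //; lia.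
  by rewrite dvdn_gcd dvdnn andbT; apply/dvdnP; exists (25 * n); lia.
- split; last by move=> x _; apply: R_neq_scale.
  (* The 5 keeps the subtraction from truncating; the residue is nonzero since [k] and [l] differ,
     so [t] lies between [n] and [4 * n]. *)
  exists (n * ((l + 5 - k) %% 5)); split.
    have -> : 125 * n %/ 5 = 25 * n by lia.
    by apply/andP; split; nia.
  rewrite theta_circulant_R //; congr (circulant _ (R_ n _.+1)); lia.
Qed.

Lemma T2_theta (n k : nat) (G : graph (125 * n)) : 0 < n -> k < 5 ->
  T2 (125 * n) 5 (R_ n k.+1) G ->
  exists2 c, c < 5 & G = circulant (125 * n) (R_ n c.+1).
Proof.
move=> n0 k5 [->|[S [[_ _ _ _ [[t [_ E]] _]] ->]]]; first by exists k.
have /dvdnP[c cE] := theta_circulant_dvd n0 k5 E.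
rewrite -E cE (mulnC c n) theta_circulant_R //.
by exists ((k + c) %% 5); rewrite // ltn_pmod.
Qed.

Lemma T2_R (n k : nat) : 0 < n -> k < 5 ->
  T2 (125 * n) 5 (R_ n k.+1) =
  [set circulant (125 * n) (R_ n j) | j in [set j | 1 <= j <= 5]]%classic.
Proof.
move=> n0 k5; apply/seteqP; split=> [G|_ [[//|l] /= l5 <-]].
  by case/T2_theta=> // c c5 ->; exists c.+1.
have [->|/eqP kl] := eqVneq l k; first by left.
by right; exists (R_ n l.+1); split=> //; apply: type2_iso_R => // /esym.
Qed.

Lemma transport_group (V : zmodType) (T : Type) (f : T -> V) (g : V -> T) :
  cancel f g -> cancel g f -> is_group (fun x y => g (f x + f y)%R).
Proof.
move=> fK gK; exists (g 0%R), (fun x => g (- f x)%R); split.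
- by move=> x y z; rewrite !gK addrA.
- by move=> x; rewrite gK add0r fK.
- by move=> x; rewrite gK addr0 fK.
- by move=> x; rewrite gK addNr.
- by move=> x; rewrite gK addrN.
Qed.

Lemma T2_group (n k : nat) : 0 < n -> k < 5 ->
  exists op : T2 (125 * n) 5 (R_ n k.+1) -> T2 (125 * n) 5 (R_ n k.+1) ->
              T2 (125 * n) 5 (R_ n k.+1),
    is_type2_op op /\ is_group op.
Proof.
move=> n0 k5; set T := T2 (125 * n) 5 (R_ n k.+1).
pose G c := theta_graph 5 (n * c) (circulant (125 * n) (R_ n k.+1)).
have GE c : G c = circulant (125 * n) (R_ n ((k + c) %% 5).+1).
  exact: theta_circulant_R.
have Gmod c c' : c = c' %[mod 5] -> G c = G c'.
  by move=> cc'; rewrite !GE -modnDmr cc' modnDmr.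
have G_inj c c' : G c = G c' -> c = c' %[mod 5].
  rewrite !GE => /circulant_R_inj E.
  by apply/eqP; rewrite -(eqn_modDl k) E ?ltn_pmod.
have GT c : T (G c).
  by rewrite /T T2_R // GE; exists ((k + c) %% 5).+1 => //=; rewrite ltn_pmod.
have GS (t : nat) : T (theta_graph 5 t (circulant (125 * n) (R_ n k.+1))) ->
    exists c, t = n * c.
  move=> /T2_theta[] // c c5 /theta_circulant_dvd -/(_ n0 k5)/dvdnP[q ->].
  by exists q; rewrite mulnC.
(* ['I_5] carries the additive group Z/5, which is transported along the bijection [g]. *)
pose g (p : 'I_5) : T := SigSub (mem_set (GT p)).
have g_surj (x : T) : exists p, g p = x.
  case: (T2_theta n0 k5 (set_valP x)) => c c5 xE.
  exists (inord ((c + 5 - k) %% 5)); apply: val_inj => /=.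
  rewrite inordK ?ltn_pmod // GE xE; congr (circulant _ (R_ n _.+1)); lia.
have [f fK] := choice g_surj.
have gK : cancel g f.
  move=> p; apply: val_inj; have := congr1 val (fK (g p)) => /= /G_inj.
  by rewrite !modn_small.
exists (fun x y => g (f x + f y)%R); split; last exact: transport_group.
move=> x y t t' _ _ xE yE /=.
have [c tE] : exists c, t = n * c by apply: GS; rewrite -xE; apply: set_valP.
have [c' tE'] : exists c, t' = n * c by apply: GS; rewrite -yE; apply: set_valP.
have fxE : f x = c %[mod 5].
  by apply: G_inj; have := congr1 val (fK x) => /= ->; rewrite xE tE.
have fyE : f y = c' %[mod 5].
  by apply: G_inj; have := congr1 val (fK y) => /= ->; rewrite yE tE'.
(* Reducing [t + t'] modulo 25n reduces [c + c'] modulo 25, which does not affect its class modulo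
   5; hence the operation does not depend on the chosen [t] and [t']. *)
have -> : (t + t') %% (125 * n %/ 5) = n * ((c + c') %% 25).
  have -> : 125 * n %/ 5 = n * 25 by lia.
  by rewrite tE tE' -mulnDr -muln_modr.
apply: Gmod; rewrite modn_mod modn_dvdm //.
by rewrite -modnDml fxE modnDml -modnDmr fyE modnDmr.
Qed.

Theorem theorem5p10 (n : nat) (n_gt0 : 0 < n) :
  [/\ forall i j, 1 <= i <= 5 -> 1 <= j <= 5 -> i <> j ->
        type2_iso (125 * n) 5 (R_ n i) (R_ n j),
      forall i, 1 <= i <= 5 ->
        T2 (125 * n) 5 (R_ n i) =
        [set circulant (125 * n) (R_ n j) | j in [set j | 1 <= j <= 5]]%classic
    & forall i, 1 <= i <= 5 ->
        exists op : T2 (125 * n) 5 (R_ n i) -> T2 (125 * n) 5 (R_ n i) ->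
                    T2 (125 * n) 5 (R_ n i),
          is_type2_op op /\ is_group op].
Proof.
split=> [[//|k] [//|l] k5 l5 kl|[//|k] k5|[//|k] k5].
- by apply: type2_iso_R => // E; apply: kl; rewrite E.
- exact: T2_R.
- exact: T2_group.
Qed.
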